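(* An arbitrary non-Lie Leibniz algebra of the set $L(4,1)$ is isomorphic to one of the following pairwise non-isomorphic algebras $L_1$, $L_2$, $L_3$. Each has basis $\{N_{12},N_{23},N_{34},N_{13},N_{24},N_{14},X\}$, where the products among the $N_{ij}$ are those of $T(4)$, the products involving $X$ are as listed (with complex parameters), and all omitted products involving $X$ are zero. $L_1$: $$[N_{12},X]=a_{12,24}N_{24},\quad [X,N_{12}]=-a_{12,24}N_{24}+b_{12,14}N_{14},$$ $$[N_{23},X]=-[X,N_{23}]=N_{23},\quad [N_{34},X]=-[X,N_{34}]=-N_{34},$$ $$[N_{13},X]=-[X,N_{13}]=N_{13},\quad [X,X]=\sigma_{14}N_{14},$$ where $(b_{12,14},\sigma_{14})\neq(0,0)$. $L_2$: $$[N_{12},X]=-[X,N_{12}]=N_{12},\quad [N_{34},X]=-[X,N_{34}]=-N_{34},$$ $$[N_{13},X]=-[X,N_{13}]=N_{13},\quad [N_{24},X]=-[X,N_{24}]=-N_{24},$$ $$[N_{23},X]=a_{23,14}N_{14},\quad [X,N_{23}]=b_{23,14}N_{14},\quad [X,X]=\sigma_{14}N_{14},$$ where $(a_{23,14}+b_{23,14},\sigma_{14})\neq(0,0)$. $L_3$: $$[N_{12},X]=-[X,N_{12}]=N_{12},\quad [N_{23},X]=-[X,N_{23}]=a_{23,23}N_{23},$$ $$[N_{34},X]=-[X,N_{34}]=-(1+a_{23,23})N_{34},\quad [N_{13},X]=-[X,N_{13}]=(1+a_{23,23})N_{13},$$ $$[N_{24},X]=-[X,N_{24}]=-N_{24},\quad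 [X,X]=N_{14},$$ where $(1+a_{23,23})a_{23,23}\neq 0$.
   Context: All vector spaces and algebras are finite-dimensional over $\mathbb{C}$. A (right) Leibniz algebra is an algebra $(L,[-,-])$ satisfying $[x,[y,z]]=[[x,y],z]-[[x,z],y]$ for all $x,y,z\in L$. The lower central series is $L^1=L$, $L^{k+1}=[L^k,L]$ and the derived series is $L^{[1]}=L$, $L^{[s+1]}=[L^{[s]},L^{[s]}]$; $L$ is nilpotent (resp. solvable) if $L^{k}=0$ (resp. $L^{[m]}=0$) for some $k$ (resp. $m$). The nilradical of $L$ is its maximal nilpotent (two-sided) ideal. $T(4)$ denotes the Lie algebra of strictly upper triangular $4\times 4$ complex matrices, with basis $\{N_{ij} : 1\le i<j\le 4\}$, where $N_{ij}$ is the matrix whose only non-zero entry is a 1 in row $i$ and column $j$, and with products $[N_{ij},N_{kl}]=\delta_{jk}N_{il}-\delta_{il}N_{kj}$. $L(4,1)$ denotes the set of all non-nilpotent solvable Leibniz algebras with nilradical $T(4)$ and a one-dimensional complementary vector space $\langle X\rangle$ to the nilradical. ''Non-Lie'' means that the Leibniz algebra is not a Lie algebra. *)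

(* Defs.v *)
From HB Require Import structures.
From mathcomp Require Import all_boot all_order all_algebra.
From mathcomp Require Import reals complex.

Set Implicit Arguments.
Unset Strict Implicit.
Unset Printing Implicit Defensive.
Import GRing.Theory.
Local Open Scope ring_scope.

(** An algebra is a [vectType] together with a bracket [br]. *)

Section Bracket.
Variables (F : fieldType) (L : vectType F) (br : L -> L -> L).
Implicit Types (x y z : L) (U V N I : {vspace L}).

Definition leibniz_algebra : Prop :=
  forall x y z, br x (br y z) = br (br x y) z - br (br x z) y.

Definition lie_algebra : Prop :=
  (forall x, br x x = 0) /\
  (forall x y z, br x (br y z) + br y (br z x) + br z (br x y) = 0).

(* The span of all the brackets [br u v] with u in U and v in V; as for [prodv]
   in falgebra, bases suffice because [br] is bilinear. *)
Definition brv U V : {vspace L} := <<allpairs br (vbasis U) (vbasis V)>>%VS.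

(* The terms of index k.+1 of the two series of the subalgebra U. *)
Definition lower_central U k : {vspace L} := iter k (fun V => brv V U) U.
Definition derived U k : {vspace L} := iter k (fun V => brv V V) U.

Definition nilpotent_sub U : Prop := exists k, lower_central U k = 0%VS.
Definition solvable_sub U : Prop := exists k, derived U k = 0%VS.

Definition is_ideal I : Prop :=
  forall x y, x \in I -> br x y \in I /\ br y x \in I.

(* Maximality is for inclusion. *)
Definition is_nilradical N : Prop :=
  [/\ is_ideal N, nilpotent_sub N
    & forall I, is_ideal I -> nilpotent_sub I -> (N <= I)%VS -> I = N].

End Bracket.

(* The subalgebra U of (A, brA) is isomorphic to the subalgebra V of (B, brB). *)
Definition isomorphic (F : fieldType) (A B : vectType F)
    (brA : A -> A -> A) (U : {vspace A})
    (brB : B -> B -> B) (V : {vspace B}) : Prop :=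
  exists f : 'Hom(A, B),
    [/\ {in U &, injective f}, (f @: U)%VS = V
      & {in U &, forall x y, f (brA x y) = brB (f x) (f y)}].

Definition commutator (F : fieldType) n (A B : 'M[F]_n) : 'M[F]_n :=
  A *m B - B *m A.

(* The space of strictly upper triangular matrices, spanned by the matrix units
   N_ij, i < j. *)
Definition strict_upper (F : fieldType) n : {vspace 'M[F]_n} :=
  (\sum_(p : 'I_n * 'I_n | (p.1 < p.2)%N) <[delta_mx p.1 p.2]>)%VS.

(* "Nilradical T(4)" is read up to isomorphism. *)
Definition in_L41 (F : fieldType) (L : vectType F) (br : L -> L -> L) : Prop :=
  [/\ leibniz_algebra br, ~ nilpotent_sub br fullv, solvable_sub br fullv
    & exists N : {vspace L},
      [/\ is_nilradical br N,
          isomorphic (@commutator F 4) (strict_upper F 4) br N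
        & exists X : L, [/\ \dim <[X]> = 1%N, (N :&: <[X]> = 0)%VS
                          & (N + <[X]> = fullv)%VS]]].

Inductive gen := N12 | N23 | N34 | N13 | N24 | N14 | X.

Definition gen_code (g : gen) : 'I_7 :=
  inord match g with
        | N12 => 0 | N23 => 1 | N34 => 2 | N13 => 3 | N24 => 4 | N14 => 5 | X => 6
        end.

Definition gen_decode (i : 'I_7) : gen :=
  nth X [:: N12; N23; N34; N13; N24; N14; X] i.

Lemma gen_codeK : cancel gen_code gen_decode.
Proof. by case; rewrite /gen_code /gen_decode inordK. Qed.

HB.instance Definition _ := Finite.copy gen (can_type gen_codeK).

Section Tables.
Variable F : fieldType.

Definition V7 : vectType F := {ffun gen -> F^o}.

Definition e (g : gen) : V7 := [ffun h => (h == g)%:R].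

(* The bracket with [e g, e h] = t g h. *)
Definition table_bracket (t : gen -> gen -> V7) (u v : V7) : V7 :=
  \sum_g \sum_h (u g * v h) *: t g h.

(* The products of T(4): [N_ij, N_kl] = delta_jk N_il - delta_il N_kj. *)
Definition tableT4 (g h : gen) : V7 :=
  match g, h with
  | N12, N23 => e N13 | N23, N12 => - e N13
  | N23, N34 => e N24 | N34, N23 => - e N24
  | N12, N24 => e N14 | N24, N12 => - e N14
  | N13, N34 => e N14 | N34, N13 => - e N14
  | _, _ => 0
  end.

Definition L1 (a12_24 b12_14 s14 : F) : V7 -> V7 -> V7 :=
  table_bracket (fun g h => match g, h with
  | N12, X => a12_24 *: e N24 | X, N12 => - a12_24 *: e N24 + b12_14 *: e N14
  | N23, X => e N23           | X, N23 => - e N23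
  | N34, X => - e N34         | X, N34 => e N34
  | N13, X => e N13           | X, N13 => - e N13
  | X, X => s14 *: e N14
  | _, _ => tableT4 g h
  end).

Definition L2 (a23_14 b23_14 s14 : F) : V7 -> V7 -> V7 :=
  table_bracket (fun g h => match g, h with
  | N12, X => e N12           | X, N12 => - e N12
  | N34, X => - e N34         | X, N34 => e N34
  | N13, X => e N13           | X, N13 => - e N13
  | N24, X => - e N24         | X, N24 => e N24
  | N23, X => a23_14 *: e N14 | X, N23 => b23_14 *: e N14
  | X, X => s14 *: e N14
  | _, _ => tableT4 g h
  end).

Definition L3 (a23_23 : F) : V7 -> V7 -> V7 :=
  table_bracket (fun g h => match g, h with
  | N12, X => e N12                   | X, N12 => - e N12
  | N23, X => a23_23 *: e N23         | X, N23 => - a23_23 *: e N23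
  | N34, X => - (1 + a23_23) *: e N34 | X, N34 => (1 + a23_23) *: e N34
  | N13, X => (1 + a23_23) *: e N13   | X, N13 => - (1 + a23_23) *: e N13
  | N24, X => - e N24                 | X, N24 => e N24
  | X, X => e N14
  | _, _ => tableT4 g h
  end).

Definition L1_params (a12_24 b12_14 s14 : F) : Prop := (b12_14, s14) <> (0, 0).
Definition L2_params (a23_14 b23_14 s14 : F) : Prop :=
  (a23_14 + b23_14, s14) <> (0, 0).
Definition L3_params (a23_23 : F) : Prop := (1 + a23_23) * a23_23 <> 0.

End Tables.

Notation "A ~= B" := (isomorphic A fullv B fullv) (at level 70).

(* Main.v *)
(* [X, -] and [-, X] both act on T(4) as derivations; as [y, [z, X] + [X, z]] = 0
   for y in T(4), the left action is minus the right one up to a linear form f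
   with values in the centre <N14>, and [X, X] = s N14.  If a12, a23, a34 are the
   eigenvalues of the right action on the generators, the Leibniz identity gives
   f (Nij) aij = 0 and (a12 + a23 + a34) f = (a12 + a23 + a34) s = 0, so that being
   non-Lie forces a12 + a23 + a34 = 0, and being non-nilpotent forces some aij to be
   non-zero.  Replacing X by X + n removes the inner part of the action; of the outer
   nilpotent part and of f only the components of weight 0 survive.  This yields L3
   when no aij vanishes, L2 when a23 = 0, and L1 when a12 = 0 or, by the diagram
   automorphism of T(4), a34 = 0.  The dimensions of [L, L] and [[L, L], [L, L]]
   tell the three families apart. *)
Require Import Defs.
From HB Require Import structures.
From mathcomp Require Import all_boot all_order all_algebra.
From mathcomp Require Import reals complex.
From mathcomp Require Import ring.
Set Implicit Arguments.
Unset Strict Implicit.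
Unset Printing Implicit Defensive.
Import GRing.Theory.
Local Open Scope ring_scope.

(** * Isomorphisms of whole algebras as linear bijections that preserve the brackets *)

Section Isomorphisms.
Variable F : fieldType.

Lemma isomorphicI (A B : vectType F) (brA : A -> A -> A) (brB : B -> B -> B)
    (f : A -> B) (g : B -> A) :
  linear f -> cancel f g -> cancel g f ->
  (forall x y, f (brA x y) = brB (f x) (f y)) -> brA ~= brB.
Proof.
move=> linf fK gK fM.
pose fL := HB.pack_for {linear A -> B} f (GRing.isLinear.Build _ _ _ _ f linf).
have lfE x : linfun fL x = f x by rewrite lfunE.
exists (linfun fL); split=> [x y _ _||x y _ _]; rewrite ?lfE //.
  exact: (can_inj fK).
apply/vspaceP=> y; rewrite memvf.
by apply/memv_imgP; exists (g y); rewrite ?memvf // lfE gK.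
Qed.

Lemma isomorphicE (A B : vectType F) (brA : A -> A -> A) (brB : B -> B -> B) :
  brA ~= brB -> exists f : 'Hom(A, B),
    [/\ cancel f (f^-1)%VF, cancel (f^-1)%VF f
      & forall x y, f (brA x y) = brB (f x) (f y)].
Proof.
case=> f [injf imf fM]; exists f; split=> [||x y]; last by apply: fM; apply: memvf.
  by apply/lker0_lfunK/lker0P => x y; apply: injf; apply: memvf.
by move=> y; apply: limg_lfunVK; rewrite imf memvf.
Qed.

Lemma isomorphic_sym (A B : vectType F) (brA : A -> A -> A) (brB : B -> B -> B) :
  brA ~= brB -> brB ~= brA.
Proof.
case/isomorphicE=> f [fK gK fM]; apply: (isomorphicI (f := (f^-1)%VF) (g := f)) => //.
  exact: linearP.
by move=> x y; apply: (can_inj fK); rewrite fM !gK.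
Qed.

Lemma isomorphic_trans (A B C : vectType F) (brA : A -> A -> A)
    (brB : B -> B -> B) (brC : C -> C -> C) :
  brA ~= brB -> brB ~= brC -> brA ~= brC.
Proof.
case/isomorphicE=> f [fK fK' fM] /isomorphicE[g [gK gK' gM]].
apply: (isomorphicI (f := g \o f) (g := (f^-1)%VF \o (g^-1)%VF)).
- by move=> a x y; rewrite /= !linearP.
- exact: can_comp.
- exact: can_comp.
by move=> x y /=; rewrite fM gM.
Qed.

Lemma isomorphic_eqr (A B : vectType F) (brA : A -> A -> A)
    (brB brB' : B -> B -> B) :
  brB =2 brB' -> brA ~= brB -> brA ~= brB'.
Proof.
move=> eqB /isomorphicE[f [fK gK fM]].
apply: (isomorphicI (f := f) (g := (f^-1)%VF)) => //; first exact: linearP.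
by move=> x y; rewrite -eqB.
Qed.

End Isomorphisms.

(** * Coordinates in the basis N_ij, X and the general extension of T(4) *)

Definition eqgen (g h : gen) : bool :=
  match g, h with
  | N12, N12 | N23, N23 | N34, N34 | N13, N13 | N24, N24 | N14, N14 | X, X => true
  | _, _ => false
  end.

(** Equality on [gen] is inherited from ['I_7] through [inord]; a boolean match evaluates more
    readily on constructors. *)
Lemma eq_genE g h : (g == h) = eqgen g h.
Proof. by apply/eqP/idP => [->|]; [case: h|case: g; case: h]. Qed.

Lemma big_gen (V : nmodType) (f : gen -> V) :
  \sum_g f g = f N12 + f N23 + f N34 + f N13 + f N24 + f N14 + f X.
Proof.
rewrite (perm_big [:: N12; N23; N34; N13; N24; N14; X]) /=.
  by rewrite !big_cons big_nil addr0 !addrA.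
apply: uniq_perm; first exact: index_enum_uniq.
  by rewrite /= !inE !eq_genE.
by move=> g; rewrite mem_index_enum !inE !eq_genE; case: g.
Qed.

(* Locked, since unfolding it makes rewriting with vecE prohibitively slow. *)
HB.lock Definition vec7 (F : fieldType) (x12 x23 x34 x13 x24 x14 xX : F) : V7 F :=
  [ffun g => match g with
   | N12 => x12 | N23 => x23 | N34 => x34 | N13 => x13 | N24 => x24 | N14 => x14
   | X => xX end].

Section Brackets.
Variable F : fieldType.
Implicit Types u v : V7 F.
Local Notation vec := (@vec7 F).

Lemma V7P u v :
  [/\ u N12 = v N12, u N23 = v N23, u N34 = v N34 & u N13 = v N13] ->
  [/\ u N24 = v N24, u N14 = v N14 & u X = v X] -> u = v.
Proof. by case=> ? ? ? ? [? ? ?]; apply/ffunP; case. Qed.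

Lemma vecE x12 x23 x34 x13 x24 x14 xX (u := vec x12 x23 x34 x13 x24 x14 xX) :
  ((u N12 = x12) * (u N23 = x23) * (u N34 = x34) * (u N13 = x13) *
  (u N24 = x24) * (u N14 = x14) * (u X = xX))%type.
Proof. by rewrite /u vec7.unlock !ffunE. Qed.

Lemma V7_ind (P : V7 F -> Prop) :
  (forall x12 x23 x34 x13 x24 x14 xX, P (vec x12 x23 x34 x13 x24 x14 xX)) ->
  forall u, P u.
Proof.
move=> Pmk u; rewrite (_ : u = vec (u N12) (u N23) (u N34) (u N13) (u N24) (u N14) (u X)) //.
by apply: V7P; rewrite !vecE.
Qed.

Lemma vec_linear c x12 x23 x34 x13 x24 x14 xX y12 y23 y34 y13 y24 y14 yX :
  c *: vec x12 x23 x34 x13 x24 x14 xX + vec y12 y23 y34 y13 y24 y14 yX =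
  vec (c * x12 + y12) (c * x23 + y23) (c * x34 + y34) (c * x13 + y13)
    (c * x24 + y24) (c * x14 + y14) (c * xX + yX).
Proof. by apply: V7P; rewrite !(ffunE, vecE). Qed.

(* The general extension: the p, q and r are the coefficients of [N12, X], [N23, X]
   and [N34, X] (that of N24 in [N34, X] has to be - p13), f is the form with
   [X, n] = - [n, X] + f n N14, and [X, X] = s N14. *)
Definition ext_bracket (a12 a23 a34 p13 p24 p14 q13 q24 q14 r13 r14 f12 f23 f34 s : F)
    (u v : V7 F) : V7 F :=
  let w g := u g * v X - u X * v g in
  vec (a12 * w N12) (a23 * w N23) (a34 * w N34)
    ((a12 + a23) * w N13 + p13 * w N12 + q13 * w N23 + r13 * w N34
     + (u N12 * v N23 - u N23 * v N12))
    ((a23 + a34) * w N24 + p24 * w N12 + q24 * w N23 - p13 * w N34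
     + (u N23 * v N34 - u N34 * v N23))
    ((a12 + a23 + a34) * w N14 + p14 * w N12 + q14 * w N23
     + r14 * w N34 + q24 * w N13 + q13 * w N24
     + (u N12 * v N24 - u N24 * v N12) + (u N13 * v N34 - u N34 * v N13)
     + u X * (f12 * v N12 + f23 * v N23 + f34 * v N34) + s * (u X * v X))
    0.

(* The case where the inner part of the action of X has been removed. *)
Definition red_bracket a12 a23 a34 p24 q14 r13 f12 f23 f34 s :=
  ext_bracket a12 a23 a34 0 p24 0 0 0 q14 r13 0 f12 f23 f34 s.

Lemma table_bracketE (t : gen -> gen -> V7 F) u v k :
  table_bracket t u v k = \sum_g \sum_h (u g * v h) * (t g h k : F).
Proof.
rewrite /table_bracket sum_ffunE; apply: eq_bigr => g _.
by rewrite sum_ffunE; apply: eq_bigr => h _; rewrite ffunE.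
Qed.

Lemma eE g k : e F g k = (eqgen k g)%:R.
Proof. by rewrite ffunE eq_genE. Qed.

Lemma addr3_eq0 (a b c : F) : a + b + c = 0 -> c = - (a + b).
Proof. by move/eqP; rewrite addrC addr_eq0 => /eqP. Qed.

End Brackets.

Ltac table_bracket_coords :=
  elim/V7_ind=> ? ? ? ? ? ? ?; elim/V7_ind=> ? ? ? ? ? ? ?;
  let k := fresh in apply/ffunP=> k;
  rewrite table_bracketE big_gen !big_gen /= !ffunE !eq_genE !vecE /GRing.scale
    /red_bracket /ext_bracket; case: k; rewrite !vecE /=; ring.

Tactic Notation "vec_eq" tactic(tac) :=
  repeat (elim/V7_ind=> ? ? ? ? ? ? ?);
  rewrite /red_bracket /ext_bracket ?(vec_linear, vecE) ?vec_linear; congr vec7; tac.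

(** * Changes of basis between extensions, and the tables of L1, L2, L3 as reduced brackets *)

Section ReducedBrackets.
Variable F : fieldType.
Local Notation vec := (@vec7 F).

Lemma red_L1 (a b s : F) : red_bracket 0 1 (-1) a 0 0 b 0 0 s =2 L1 a b s.
Proof. table_bracket_coords. Qed.

Lemma red_L2 (a b s : F) : red_bracket 1 0 (-1) 0 a 0 0 (a + b) 0 s =2 L2 a b s.
Proof. table_bracket_coords. Qed.

Lemma red_L3 (a : F) : red_bracket 1 a (- (1 + a)) 0 0 0 0 0 0 1 =2 L3 a.
Proof. table_bracket_coords. Qed.

(** The basis change is X -> X + n with n = q13 N12 - p13 N23 - q24 N34 + r14 N13 - p14 N24, whose
    inner derivation cancels p13, p14, q13, q24 and r14. As [X + n, X + n] = (s + f n) N14, the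
    constant s moves by f n. *)
Lemma ext_red a12 a23 a34 p13 p24 p14 q13 q24 q14 r13 r14 f12 f23 f34 (s : F) :
  a12 + a23 + a34 = 0 ->
  ext_bracket a12 a23 a34 p13 p24 p14 q13 q24 q14 r13 r14 f12 f23 f34 s ~=
  red_bracket a12 a23 a34 p24 q14 r13 f12 f23 f34
    (s + f12 * q13 - f23 * p13 - f34 * q24).
Proof.
move=> /addr3_eq0->; apply: isomorphic_sym.
pose f (u : V7 F) := vec (u N12 + q13 * u X) (u N23 - p13 * u X)
  (u N34 - q24 * u X) (u N13 + r14 * u X) (u N24 - p14 * u X) (u N14) (u X).
pose g (u : V7 F) := vec (u N12 - q13 * u X) (u N23 + p13 * u X)
  (u N34 + q24 * u X) (u N13 - r14 * u X) (u N24 + p14 * u X) (u N14) (u X).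
apply: (isomorphicI (f := f) (g := g)); rewrite /f /g.
- move=> c; vec_eq ring.
- vec_eq ring.
- vec_eq ring.
- vec_eq ring.
Qed.

(* Basis change N12 -> k (N12 + x N24), N23 -> N23 + y N14, N34 -> N34 + z N13,
   X -> t X. *)
Lemma red_rescale k t x y z a12 a23 a34 p24 q14 r13 f12 f23 f34 s
    b12 b23 b34 p24' q14' r13' g12 g23 g34 (s' : F) :
  a12 + a23 + a34 = 0 -> k != 0 -> t != 0 ->
  [/\ b12 = t * a12, b23 = t * a23 & b34 = t * a34] ->
  [/\ p24' = t * k * (p24 - 2 * a12 * x), q14' = t * (q14 - a23 * y) / k
    & r13' = t * (r13 - 2 * a34 * z) / k] ->
  [/\ g12 = t * f12, g23 = t * f23 / k, g34 = t * f34 / k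
    & s' = t ^+ 2 * s / k] ->
  red_bracket a12 a23 a34 p24 q14 r13 f12 f23 f34 s ~=
  red_bracket b12 b23 b34 p24' q14' r13' g12 g23 g34 s'.
Proof.
move=> /addr3_eq0-> k0 t0 [-> -> ->] [-> -> ->] [-> -> -> ->].
apply: isomorphic_sym.
pose f (u : V7 F) := vec (k * u N12) (u N23)
  (u N34) (k * u N13 + z * u N34) (u N24 + k * x * u N12)
  (k * u N14 + y * u N23) (t * u X).
pose g (u : V7 F) := vec (u N12 / k) (u N23)
  (u N34) ((u N13 - z * u N34) / k) (u N24 - x * u N12)
  ((u N14 - y * u N23) / k) (u X / t).
apply: (isomorphicI (f := f) (g := g)); rewrite /f /g.
- move=> c; vec_eq ring.
- vec_eq (by field; rewrite ?k0 ?t0).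
- vec_eq (by field; rewrite ?k0 ?t0).
- vec_eq (by field; rewrite ?k0 ?t0).
Qed.

(* The diagram automorphism of T(4), which exchanges N12 and N34. *)
Lemma red_flip a12 a23 a34 p24 q14 r13 f12 f23 f34 (s : F) :
  a12 + a23 + a34 = 0 ->
  red_bracket a12 a23 a34 p24 q14 r13 f12 f23 f34 s ~=
  red_bracket a34 a23 a12 (- r13) q14 (- p24) f34 f23 f12 s.
Proof.
move=> /addr3_eq0->; apply: isomorphic_sym.
pose f (u : V7 F) := vec (u N34) (u N23) (u N12) (- u N24) (- u N13) (u N14) (u X).
have fK : cancel f f by rewrite /f; vec_eq ring.
apply: (isomorphicI (f := f) (g := f)) => //; rewrite /f.
- move=> c; vec_eq ring.
- vec_eq ring.
Qed.

End ReducedBrackets.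

(** * Normal forms of the reduced brackets *)

Section Normalization.
Variable F : fieldType.

Definition in_families (L : vectType F) (br : L -> L -> L) : Prop :=
  [\/ exists a b s : F, L1_params a b s /\ br ~= L1 a b s,
      exists a b s : F, L2_params a b s /\ br ~= L2 a b s
    | exists a : F, L3_params a /\ br ~= L3 a].

(** The sum of the eigenvalues is 0 and they do not all vanish, so at most one of them is 0. The
    weights of p24, q14 and r13 are then -2 a12, - a23 and -2 a34: a coefficient of non-zero weight
    is removed by [red_rescale], one of weight 0 remains as a parameter. *)
Lemma red_classification a12 a23 a34 p24 q14 r13 f12 f23 f34 (s : F) :
  (2 : F) != 0 -> a12 + a23 + a34 = 0 -> (a12, a23) != (0, 0) ->
  f12 * a12 = 0 -> f23 * a23 = 0 -> f34 * a34 = 0 ->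
  (f12, f23, f34, s) != (0, 0, 0, 0) ->
  in_families (red_bracket a12 a23 a34 p24 q14 r13 f12 f23 f34 s).
Proof.
move=> two0.
have reg (f a : F) : f * a = 0 -> a != 0 -> f = 0.
  by move=> /eqP fa a0; move: fa; rewrite mulf_eq0 (negPf a0) orbF => /eqP.
have reg' (a f : F) : a * f = 0 -> a != 0 -> f = 0 by rewrite mulrC; apply: reg.
(* The case a12 = 0 is stated for arbitrary constants, since it is applied again after the flip when
   a34 = 0. *)
have type1 b23 b34 p q r g12 g23 g34 (s' : F) : 0 + b23 + b34 = 0 -> b23 != 0 ->
    g23 * b23 = 0 -> g34 * b34 = 0 -> (g12, g23, g34, s') != (0, 0, 0, 0) ->
    exists a b s, L1_params a b s /\ red_bracket 0 b23 b34 p q r g12 g23 g34 s' ~= L1 a b s.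
  move=> S0 b0 g230 g340 nz.
  have b34E : b34 = - b23 by rewrite (addr3_eq0 S0) add0r.
  rewrite (reg _ _ g230) // (reg _ _ g340) ?b34E ?oppr_eq0 // in nz *.
  have t0 : b23^-1 != 0 by rewrite invr_eq0.
  exists (b23^-1 * p), (b23^-1 * g12), (b23^-1 ^+ 2 * s'); split.
    move: nz => /[swap] -[/reg' /(_ t0)->].
    by move=> /reg' ->; rewrite ?expf_neq0 // eqxx.
  apply: isomorphic_eqr (red_L1 _ _ _) _.
  (* [y] and [z] cancel [q] and [r], with b34 = - b23 giving the sign of [z]; [p] has weight 0 and
     survives. *)
  apply: (red_rescale (k := 1) (t := b23^-1) (x := 0) (y := q / b23)
    (z := - (r / (2 * b23)))); rewrite ?oner_neq0 //.
  - by rewrite add0r subrr.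
  - by split; field; rewrite ?oner_neq0 ?b0.
  - by split; field; rewrite ?oner_neq0 ?b0 ?two0.
  - by split; field; rewrite ?oner_neq0 ?b0.
move=> S0 a0 f120 f230 f340 nz; rewrite /in_families.
have [a12_0|a12_n0] := eqVneq a12 0.
  subst a12; apply: Or31; apply: type1 => //.
  by move: a0; rewrite xpair_eqE eqxx.
have a34E := addr3_eq0 S0.
have t0 : a12^-1 != 0 by rewrite invr_eq0.
rewrite (reg _ _ f120) // in nz *.
have [a23_0|a23_n0] := eqVneq a23 0.
  subst a23; apply: Or32.
  rewrite (reg _ _ f340) ?a34E ?addr0 ?oppr_eq0 // in nz *.
  (* In [red_L2] the form takes the value a + b on N23, so b is the rescaled f23 - q14. *)
  exists (a12^-1 * q14), (a12^-1 * (f23 - q14)), (a12^-1 ^+ 2 * s); split.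
    rewrite /L2_params -mulrDr addrC subrK => -[/reg' /(_ t0) f0].
    by move=> /reg' s0; rewrite f0 s0 ?expf_neq0 // eqxx in nz.
  apply: isomorphic_eqr (red_L2 _ _ _) _.
  apply: (red_rescale (k := 1) (t := a12^-1) (x := p24 / (2 * a12)) (y := 0)
    (z := - (r13 / (2 * a12)))); rewrite ?oner_neq0 //.
  - by rewrite addr0 subrr.
  - by split; field; rewrite ?oner_neq0 ?a12_n0.
  - by split; field; rewrite ?oner_neq0 ?a12_n0 ?two0.
  - by split; field; rewrite ?oner_neq0 ?a12_n0.
have [a34_0|a34_n0] := eqVneq a34 0.
  rewrite a34_0 in S0 *; apply: Or31.
  have [|||||a [b [s' [ok iso]]]] := type1 a23 a12 (- r13) q14 (- p24) f34 f23 0 s => //.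
  - by move: S0; rewrite addr0 add0r addrC.
  - by rewrite mul0r.
  - by apply: contraNneq nz => -[-> -> ->].
  exists a, b, s'; split=> //; apply: isomorphic_trans iso; exact: red_flip.
apply: Or33; rewrite (reg _ _ f230) // (reg _ _ f340) // in nz *.
have s0 : s != 0 by apply: contraNneq nz => ->.
exists (a12^-1 * a23); split; rewrite ?/L3_params.
  (* 1 + a23 / a12 = - a34 / a12, so the condition on the parameter amounts to a34 and a23 being
     non-zero. *)
  have -> : (1 + a12^-1 * a23) * (a12^-1 * a23) = - (a34 * a23) * a12^-1 ^+ 2.
    by rewrite a34E; field.
  by apply/eqP; rewrite !(mulf_eq0, oppr_eq0, expf_eq0) invr_eq0 !negb_or a34_n0 a23_n0 a12_n0.
apply: isomorphic_eqr (red_L3 _) _.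
(* [k] solves t^2 s / k = 1, which turns [X, X] into N14. *)
apply: (red_rescale (k := a12^-1 ^+ 2 * s) (t := a12^-1) (x := p24 / (2 * a12))
  (y := q14 / a23) (z := r13 / (2 * a34))); rewrite ?mulf_neq0 ?expf_neq0 //.
- by rewrite a34E; split; field.
- by split; field; rewrite ?oner_neq0 ?a12_n0 ?two0 ?a34_n0 ?a23_n0 ?s0.
- by split; field; rewrite ?oner_neq0 ?a12_n0 ?two0 ?a34_n0 ?a23_n0 ?s0.
Qed.

End Normalization.

(** * The Leibniz identity in structure constants *)

Section StructureConstants.
Variable F : fieldType.

Definition T4_coord (g h k : gen) : F :=
  match g, h, k with
  | N12, N23, N13 | N23, N34, N24 | N12, N24, N14 | N13, N34, N14 => 1
  | N23, N12, N13 | N34, N23, N24 | N24, N12, N14 | N34, N13, N14 => -1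
  | _, _, _ => 0
  end.

(* Structure constants of an extension of T(4) by X: r, l and s are the
   coordinates of [N_ij, X], [X, N_ij] and [X, X]. *)
Definition ext_coord (r l : gen -> gen -> F) (s : gen -> F) (g h k : gen) : F :=
  match k with
  | X => 0
  | _ => match g, h with
         | X, X => s k
         | X, _ => l h k
         | _, X => r g k
         | _, _ => T4_coord g h k
         end
  end.

(** Lets [ring] extract a relation from an instance of the Leibniz identity, whichever sign it comes
    with. *)
Lemma eq_of_eq (a b x y : F) : a = b -> x - y = a - b \/ x - y = b - a -> x = y.
Proof. by move=> -> [] /eqP; rewrite subrr subr_eq0 => /eqP. Qed.

Lemma opp_self_eq0 (a b : F) : (2 : F) != 0 -> a = - b -> a = b -> a = 0.
Proof.
move=> two0 -> /eqP; rewrite eq_sym -addr_eq0 -mulr2n -mulr_natl mulf_eq0 (negPf two0).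
by move=> /eqP->; rewrite oppr0.
Qed.

Ltac by_leibniz H :=
  apply: eq_of_eq H _; rewrite ?big_gen /=; by [left; ring | right; ring].

Ltac forget_coords u :=
  move: (u N12) (u N23) (u N34) (u N13) (u N24) (u N14) (u X) => ? ? ? ? ? ? ?.

Definition in_T4 (g : gen) : bool := if g is X then false else true.
Definition noncentral (g : gen) : bool := if g is (N14 | X) then false else true.

(** Each relation is one coordinate of the identity on a triple of basis vectors, [leib x y z k]
    being the coordinate [k] on (x, y, z). The form [phi] measures how far the left action of X is
    from minus the right one. *)
Lemma ext_coord_leibniz r l s (c := ext_coord r l s) :
  (2 : F) != 0 ->
  (forall x y z k, \sum_h c y z h * c x h k =
     \sum_g c x y g * c g z k - \sum_g c x z g * c g y k) ->
  let S := r N12 N12 + r N23 N23 + r N34 N34 in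
  let phi g := r g N14 + l g N14 in
  [/\ [/\ r N12 N23 = 0, r N12 N34 = 0, r N23 N12 = 0 & r N23 N34 = 0],
      [/\ r N34 N12 = 0, r N34 N23 = 0 & r N34 N24 = - r N12 N13],
      [/\ r N13 N13 = r N12 N12 + r N23 N23, r N13 N14 = r N23 N24,
          r N24 N24 = r N23 N23 + r N34 N34, r N24 N14 = r N23 N13
        & r N14 N14 = S],
      [/\ r N13 N12 = 0, r N13 N23 = 0, r N13 N34 = 0 & r N13 N24 = 0] /\
      [/\ r N24 N12 = 0, r N24 N23 = 0, r N24 N34 = 0 & r N24 N13 = 0]
    & [/\ r N14 N12 = 0, r N14 N23 = 0, r N14 N34 = 0, r N14 N13 = 0
        & r N14 N24 = 0]] /\
  [/\ forall g k, in_T4 g -> noncentral k -> l g k = - r g k,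
      [/\ phi N13 = 0, phi N24 = 0 & phi N14 = 0],
      forall k, noncentral k -> s k = 0,
      [/\ phi N12 * S = 0, phi N23 * S = 0, phi N34 * S = 0 & s N14 * S = 0]
    & [/\ phi N12 * r N12 N12 = 0, phi N23 * r N23 N23 = 0
        & phi N34 * r N34 N34 = 0]].
Proof.
move=> two0 leib S phi.
(* With X in the last place, the identity says that n -> [n, X] is a derivation of T(4), so its
   values on N13, N24 and N14 come from those on the generators. *)
have r12_23 : r N12 N23 = 0 by by_leibniz (leib N12 N34 X N24).
have r34_23 : r N34 N23 = 0 by by_leibniz (leib N12 N34 X N13).
have r34_24 : r N34 N24 = - r N12 N13 by by_leibniz (leib N12 N34 X N14).
have r13_12 : r N13 N12 = 0 by by_leibniz (leib N12 N23 X N12).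
have r13_23 : r N13 N23 = 0 by by_leibniz (leib N12 N23 X N23).
have r13_34 : r N13 N34 = 0 by by_leibniz (leib N12 N23 X N34).
have r13_13 : r N13 N13 = r N12 N12 + r N23 N23 by by_leibniz (leib N12 N23 X N13).
have r13_14 : r N13 N14 = r N23 N24 by by_leibniz (leib N12 N23 X N14).
have r24_12 : r N24 N12 = 0 by by_leibniz (leib N23 N34 X N12).
have r24_23 : r N24 N23 = 0 by by_leibniz (leib N23 N34 X N23).
have r24_34 : r N24 N34 = 0 by by_leibniz (leib N23 N34 X N34).
have r24_24 : r N24 N24 = r N23 N23 + r N34 N34 by by_leibniz (leib N23 N34 X N24).
have r24_14 : r N24 N14 = r N23 N13 by by_leibniz (leib N23 N34 X N14).
have r14_12 : r N14 N12 = 0 by by_leibniz (leib N12 N24 X N12).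
have r14_23 : r N14 N23 = 0 by by_leibniz (leib N12 N24 X N23).
have r14_34 : r N14 N34 = 0 by by_leibniz (leib N12 N24 X N34).
have r14_13 : r N14 N13 = 0 by rewrite -r24_23; by_leibniz (leib N12 N24 X N13).
have r14_24 : r N14 N24 = 0 by by_leibniz (leib N12 N24 X N24).
have r14_14 : r N14 N14 = S.
  by rewrite /S -addrA -r24_24; by_leibniz (leib N12 N24 X N14).
(* Two identities give [r N13 N24] the values - [r N12 N34] and [r N12 N34], so both constants
   vanish as 2 is non-zero; likewise for [r N24 N13] and [r N34 N12]. *)
have r13_24 : r N13 N24 = - r N12 N34 by by_leibniz (leib N12 N23 X N24).
have r24_13 : r N24 N13 = - r N34 N12 by by_leibniz (leib N23 N34 X N13).
have {}r13_24 : r N13 N24 = 0.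
  by apply: (opp_self_eq0 two0 r13_24); by_leibniz (leib N12 N13 X N14).
have {}r24_13 : r N24 N13 = 0.
  by apply: (opp_self_eq0 two0 r24_13); by_leibniz (leib N34 N24 X N14).
have r12_34 : r N12 N34 = 0 by rewrite -r13_24; by_leibniz (leib N12 N13 X N14).
have r34_12 : r N34 N12 = 0 by rewrite -r24_13; by_leibniz (leib N34 N24 X N14).
have r23_34 : r N23 N34 = 0 by by_leibniz (leib N23 N13 X N14).
have r23_12 : r N23 N12 = 0 by by_leibniz (leib N23 N24 X N14).
(* The identities on (y, z, X) and (y, X, z) have opposite right-hand sides, whence [y, [z, X] +
   [X, z]] = 0. *)
have rl0 y z k : \sum_h c z X h * c y h k = - \sum_h c X z h * c y h k.
  by rewrite !leib opprB.
(* For each non-central [k], a basis vector y that does not commute with it detects the coordinate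
   [k]. *)
have lE g k : in_T4 g -> noncentral k -> l g k = - r g k.
  case: k => //= + _.
  - by move: (rl0 N23 g N13); case: g => // H _; by_leibniz H.
  - by move: (rl0 N12 g N13); case: g => // H _; by_leibniz H.
  - by move: (rl0 N23 g N24); case: g => // H _; by_leibniz H.
  - by move: (rl0 N34 g N14); case: g => // H _; by_leibniz H.
  - by move: (rl0 N12 g N14); case: g => // H _; by_leibniz H.
have sE k : noncentral k -> s k = 0.
  case: k => //= _.
  - by_leibniz (leib N23 X X N13).
  - by_leibniz (leib N12 X X N13).
  - by_leibniz (leib N23 X X N24).
  - by_leibniz (leib N34 X X N14).
  - by_leibniz (leib N12 X X N14).
(* With X in the first place, the identity computes the left action on commutators from that on the
   generators. *)
have phi13 : phi N13 = 0.
  by rewrite /phi r13_14 -[r N23 N24]opprK -lE //; by_leibniz (leib X N12 N23 N14).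
have phi24 : phi N24 = 0.
  by rewrite /phi r24_14 -[r N23 N13]opprK -lE //; by_leibniz (leib X N23 N34 N14).
have phi14 : phi N14 = 0.
  have -> : phi N14 = r N12 N12 + r N24 N24 + l N14 N14.
    by rewrite /phi r14_14 r24_24 addrA.
  rewrite -[r N12 N12]opprK -lE // -[r N24 N24]opprK -lE //.
  by_leibniz (leib X N12 N24 N14).
have l14_14 : l N14 N14 = - S.
  by apply/eqP; rewrite -addr_eq0 -r14_14 addrC -phi14.
have s0 : [/\ s N12 = 0, s N23 = 0, s N34 = 0, s N13 = 0 & s N24 = 0].
  by split; apply: sE.
have lT g : in_T4 g -> (l g N12 = - r g N12) * (l g N23 = - r g N23) *
    (l g N34 = - r g N34) * (l g N13 = - r g N13) * (l g N24 = - r g N24).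
  by move=> gT; rewrite !lE.
(* Taking y = X in [rl0] gives [X, phi(g) N14] = 0, where [X, N14] = - S N14. *)
have phiS : [/\ phi N12 * S = 0, phi N23 * S = 0 & phi N34 * S = 0].
  split; rewrite -[S]opprK -l14_14 /phi.
  - have := rl0 X N12 N14; rewrite !big_gen /= !(lT N12 isT) => H; by_leibniz H.
  - have := rl0 X N23 N14; rewrite !big_gen /= !(lT N23 isT) => H; by_leibniz H.
  - have := rl0 X N34 N14; rewrite !big_gen /= !(lT N34 isT) => H; by_leibniz H.
have sS : s N14 * S = 0.
  rewrite -[S]opprK -l14_14; have := leib X X X N14; case: s0 => s1 s2 s3 s4 s5.
  by rewrite !big_gen /= s1 s2 s3 s4 s5 => H; by_leibniz H.
have l13_14 : l N13 N14 = - r N23 N24.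
  by apply/eqP; rewrite -addr_eq0 -r13_14 addrC -phi13.
have l24_14 : l N24 N14 = - r N23 N13.
  by apply/eqP; rewrite -addr_eq0 -r24_14 addrC -phi24.
have [phiS12 phiS23 phiS34] := phiS.
(* The identity on (X, N12, X) reduces to [phi N12 * r N12 N12 = phi N12 * S], and the right-hand
   side is already 0. *)
have phi12 : phi N12 * r N12 N12 = 0.
  rewrite -phiS12; have := leib X N12 X N14; case: s0 => s1 s2 s3 s4 s5.
  rewrite !big_gen /= !(lT N12 isT) s1 s2 s3 s4 s5 r12_23 r12_34 l13_14 l24_14.
  by rewrite l14_14 r14_14 r13_14 r24_14 /phi => H; by_leibniz H.
have phi23 : phi N23 * r N23 N23 = 0.
  rewrite -phiS23; have := leib X N23 X N14; case: s0 => s1 s2 s3 s4 s5.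
  rewrite !big_gen /= !(lT N23 isT) s1 s2 s3 s4 s5 r23_12 r23_34 l13_14 l24_14.
  by rewrite l14_14 r14_14 r13_14 r24_14 /phi => H; by_leibniz H.
have phi34 : phi N34 * r N34 N34 = 0.
  rewrite -phiS34; have := leib X N34 X N14; case: s0 => s1 s2 s3 s4 s5.
  rewrite !big_gen /= !(lT N34 isT) s1 s2 s3 s4 s5 r34_12 r34_23 l13_14 l24_14.
  by rewrite l14_14 r14_14 r13_14 r24_14 /phi => H; by_leibniz H.
by do !split.
Qed.

Lemma ext_coordE r l s u v (c := ext_coord r l s) (br : V7 F -> V7 F -> V7 F) :
  (2 : F) != 0 ->
  (forall x y z k, \sum_h c y z h * c x h k =
     \sum_g c x y g * c g z k - \sum_g c x z g * c g y k) ->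
  (forall k, br u v k = \sum_g \sum_h u g * v h * c g h k) ->
  br u v = ext_bracket (r N12 N12) (r N23 N23) (r N34 N34) (r N12 N13) (r N12 N24)
    (r N12 N14) (r N23 N13) (r N23 N24) (r N23 N14) (r N34 N13) (r N34 N14)
    (r N12 N14 + l N12 N14) (r N23 N14 + l N23 N14) (r N34 N14 + l N34 N14)
    (s N14) u v.
Proof.
move=> two0 leib brE.
have [] := ext_coord_leibniz two0 leib; rewrite -/c /=.
move=> [[r12_23 r12_34 r23_12 r23_34] [r34_12 r34_23 r34_24]
  [r13_13 r13_14 r24_24 r24_14 r14_14] [[r13_12 r13_23 r13_34 r13_24]
  [r24_12 r24_23 r24_34 r24_13]] [r14_12 r14_23 r14_34 r14_13 r14_24]].
move=> [lE [phi13 phi24 phi14] sE _ _].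
have lT g : in_T4 g -> (l g N12 = - r g N12) * (l g N23 = - r g N23) *
    (l g N34 = - r g N34) * (l g N13 = - r g N13) * (l g N24 = - r g N24).
  by move=> gT; rewrite !lE.
have [s12 s23 s34 s13 s24] : [/\ s N12 = 0, s N23 = 0, s N34 = 0, s N13 = 0 & s N24 = 0].
  by split; apply: sE.
have l13_14 : l N13 N14 = - r N23 N24.
  by apply/eqP; rewrite -addr_eq0 -r13_14 addrC phi13.
have l24_14 : l N24 N14 = - r N23 N13.
  by apply/eqP; rewrite -addr_eq0 -r24_14 addrC phi24.
have l14_14 : l N14 N14 = - r N14 N14.
  by apply/eqP; rewrite -addr_eq0 addrC phi14.
apply/ffunP; case; rewrite brE big_gen !big_gen /= /ext_bracket !vecE
  ?(lT N12 isT, lT N23 isT, lT N34 isT, lT N13 isT, lT N24 isT, lT N14 isT) ?s12 ?s23 ?s34 ?s13 ?s24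
  ?(r12_23, r12_34, r23_12, r23_34, r34_12, r34_23, r34_24, l13_14, l24_14, l14_14)
  ?(r13_13, r13_14, r24_24, r24_14, r14_14, r13_12, r13_23, r13_34, r13_24,
   r24_12, r24_23, r24_34, r24_13, r14_12, r14_23, r14_34, r14_13, r14_24).
all: forget_coords u; forget_coords v.
all: ring.
Qed.

End StructureConstants.

(** * T(4) as a space of matrices, in coordinates *)

Section StrictUpper.
Variable F : fieldType.
Local Notation vec := (@vec7 F).

(** Defined on all of [V7], with the coordinate of X ignored, so that T(4) and its extension share
    one coordinate space. *)
Definition upper_mx (u : V7 F) : 'M[F]_4 :=
  \matrix_(i, j) match val i, val j with
                 | 0%N, 1%N => u N12 | 1%N, 2%N => u N23 | 2%N, 3%N => u N34
                 | 0%N, 2%N => u N13 | 1%N, 3%N => u N24 | 0%N, 3%N => u N14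
                 | _, _ => 0
                 end.

Lemma upper_mx_linear : linear upper_mx.
Proof.
move=> c u v; apply/matrixP=> i j; rewrite !mxE.
by case: i j => -[|[|[|[|i]]]] // ? [[|[|[|[|j]]]]] // ?; rewrite /= ?ffunE ?mulr0 ?addr0.
Qed.
HB.instance Definition _ := GRing.isLinear.Build _ _ _ _ upper_mx upper_mx_linear.

Lemma upper_mx_eq0 u : upper_mx u = 0 -> u X = 0 -> u = 0.
Proof.
move=> /matrixP m0 uX; apply/ffunP=> g; rewrite ffunE; case: g => //.
- by have := m0 (@Ordinal 4 0 isT) (@Ordinal 4 1 isT); rewrite !mxE.
- by have := m0 (@Ordinal 4 1 isT) (@Ordinal 4 2 isT); rewrite !mxE.
- by have := m0 (@Ordinal 4 2 isT) (@Ordinal 4 3 isT); rewrite !mxE.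
- by have := m0 (@Ordinal 4 0 isT) (@Ordinal 4 2 isT); rewrite !mxE.
- by have := m0 (@Ordinal 4 1 isT) (@Ordinal 4 3 isT); rewrite !mxE.
- by have := m0 (@Ordinal 4 0 isT) (@Ordinal 4 3 isT); rewrite !mxE.
Qed.

Lemma commutator_upper_mx u v :
  commutator (upper_mx u) (upper_mx v) =
  upper_mx (vec 0 0 0 (u N12 * v N23 - u N23 * v N12)
    (u N23 * v N34 - u N34 * v N23)
    (u N12 * v N24 - u N24 * v N12 + (u N13 * v N34 - u N34 * v N13)) 0).
Proof.
apply/matrixP=> i j; rewrite !mxE !vecE.
rewrite !(big_ord_recl, big_ord0) !mxE /=.
move: (u N12) (u N23) (u N34) (u N13) (u N24) (u N14) => ? ? ? ? ? ?.
move: (v N12) (v N23) (v N34) (v N13) (v N24) (v N14) => ? ? ? ? ? ?.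
by case: i j => -[|[|[|[|i]]]] // ? [[|[|[|[|j]]]]] // ?; rewrite /=; ring.
Qed.

Lemma upper_mx_strict u : upper_mx u \in strict_upper F 4.
Proof.
rewrite (matrix_sum_delta (upper_mx u)) pair_bigA /=; apply: memv_suml => -[i j] _ /=.
have [lt_ij|le_ji] := ltnP i j.
  by rewrite memvZ // (subvP (sumv_sup (i, j) _ (subvv _))) // memv_line.
rewrite mxE.
by move: le_ji; case: i j => -[|[|[|[|i]]]] // ? [[|[|[|[|j]]]]] // ? _;
  rewrite /= scale0r mem0v.
Qed.

Lemma strict_upperE : strict_upper F 4 = limg (linfun upper_mx).
Proof.
apply/eqP; rewrite eqEsubv; apply/andP; split; last first.
  by apply/subvP=> _ /memv_imgP[u _ ->]; rewrite lfunE upper_mx_strict.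
apply/subv_sumP=> -[i j] /= lt_ij; rewrite -memvE.
have mx_e g : upper_mx (e F g) \in limg (linfun upper_mx).
  by rewrite -lfunE memv_img ?memvf.
suff [g <-] : exists g, upper_mx (e F g) = delta_mx i j by [].
(* The default [N14] serves (0, 3), the only remaining pair with i < j. *)
exists (match val i, val j with
        | 0%N, 1%N => N12 | 1%N, 2%N => N23 | 2%N, 3%N => N34
        | 0%N, 2%N => N13 | 1%N, 3%N => N24 | _, _ => N14
        end).
apply/matrixP=> i' j'; rewrite !mxE -!val_eqE.
case: i j lt_ij => -[|[|[|[|i]]]] // ? [[|[|[|[|j]]]]] // ? _ /=.
all: case: i' j' => -[|[|[|[|i']]]] // ? [[|[|[|[|j']]]]] // ?; by rewrite /= ?eE.
Qed.

End StrictUpper.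

(** * A basis of an algebra in L(4,1) adapted to its nilradical *)

Section Coordinates.
Variables (F : fieldType) (L : vectType F) (br : {bilinear L -> L -> L}).
Local Notation vec := (@vec7 F).

Lemma V7_sum (u : V7 F) : u = \sum_g (u g : F) *: e F g.
Proof.
apply/ffunP=> k; rewrite sum_ffunE (bigD1 k) //= big1 => [|g gk].
  by rewrite addr0 !ffunE eqxx /GRing.scale /= mulr1.
by rewrite !ffunE eq_sym (negPf gk) /GRing.scale /= mulr0.
Qed.

(** The given isomorphism onto the nilradical N is extended by sending [e X] to the complementary
    vector x. The last clause says that [L, L] lies in N: N is an ideal, so only [x, x] needs an
    argument. *)
Lemma in_L41_coordinates : in_L41 br ->
  exists f : 'Hom(V7 F, L), [/\ cancel f (f^-1)%VF, cancel (f^-1)%VF f,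
    forall u v : V7 F, u X = 0 -> v X = 0 -> br (f u) (f v) =
      f (vec 0 0 0 (u N12 * v N23 - u N23 * v N12)
        (u N23 * v N34 - u N34 * v N23)
        (u N12 * v N24 - u N24 * v N12 + (u N13 * v N34 - u N34 * v N13)) 0)
  & forall u v : V7 F, (f^-1)%VF (br (f u) (f v)) X = 0].
Proof.
case=> leib _ _ [N [[idN _ _] [h [injh imh hM]] [x [dimx capx addx]]]].
have x0 : x != 0 by move: dimx; rewrite dim_vline; case: eqP.
pose f0 (u : V7 F) := h (upper_mx u) + (u X : F) *: x.
have linf0 : linear f0.
  move=> c u v; rewrite /f0 !linearP (_ : (c *: u + v) X = c * u X + v X); last first.
    by rewrite !ffunE.
  by rewrite scalerDl scalerDr -scalerA addrACA.
pose fL := HB.pack_for {linear V7 F -> L} f0 (GRing.isLinear.Build _ _ _ _ f0 linf0).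
pose f := linfun fL.
have fE u : f u = h (upper_mx u) + (u X : F) *: x by rewrite lfunE.
have f_low (u : V7 F) : u X = 0 -> f u = h (upper_mx u) by rewrite fE => ->; rewrite scale0r addr0.
have hN (u : V7 F) : h (upper_mx u) \in N by rewrite -imh memv_img ?upper_mx_strict.
have NP y : y \in N -> exists2 u : V7 F, u X = 0 & y = f u.
  rewrite -imh strict_upperE => /memv_imgP[_ /memv_imgP[u _ ->] ->].
  exists (vec (u N12) (u N23) (u N34) (u N13) (u N24) (u N14) 0).
    by rewrite vecE.
  rewrite lfunE f_low ?vecE //; congr (h _); apply/matrixP=> i j.
  by rewrite !mxE !vecE.
have fN (u : V7 F) : f u \in N -> u X = 0.
  rewrite fE => uN; have : (u X : F) *: x \in (N :&: <[x]>)%VS.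
    rewrite memv_cap (memvZ _ (memv_line x)) andbT.
    by rewrite -[_ *: x](addKr (h (upper_mx u))) memvD ?memvN.
  by rewrite capx memv0 scaler_eq0 (negPf x0) orbF => /eqP.
have f_ker : lker f == 0%VS.
  apply/eqP/vspaceP=> u; rewrite memv_ker memv0; apply/eqP/eqP => [fu0|->]; last first.
    by rewrite linear0.
  have uX : u X = 0 by apply: fN; rewrite fu0 mem0v.
  apply: upper_mx_eq0 => //; apply: injh; rewrite ?upper_mx_strict ?mem0v //.
  by rewrite linear0 -f_low.
have fK := lker0_lfunK f_ker.
have feX : f (e F X) = x.
  rewrite fE eE /= scale1r (_ : upper_mx _ = 0) ?linear0 ?add0r //.
  apply/matrixP=> i j; rewrite !mxE !eE.
  by case: i j => -[|[|[|[|i]]]] // ? [[|[|[|[|j]]]]].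
have fK' : cancel (f^-1)%VF f.
  move=> y; apply: limg_lfunVK; have : y \in (N + <[x]>)%VS by rewrite addx memvf.
  case/memv_addP=> n /NP[u uX ->] [_ /vlineP[c ->] ->].
  apply/memv_imgP; exists (u + c *: e F X); first by rewrite memvf.
  by rewrite linearD linearZ /= feX.
exists f; split=> // [u v uX vX|u v].
  rewrite !f_low ?vecE // -hM ?upper_mx_strict //.
  by rewrite commutator_upper_mx.
apply: fN; rewrite fK'.
(* Write [x, x] = n + w x with n in N. As [x, [x, x]] = 0, w [x, x] = - [x, n] lies in N; divide by
   w, or use [x, x] = n if w = 0. *)
have xxN : br x x \in N.
  have xE : br x x = h (upper_mx ((f^-1)%VF (br x x))) + ((f^-1)%VF (br x x) X : F) *: x.
    by rewrite -fE fK'.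
  move: ((f^-1)%VF (br x x)) xE => w xE.
  have := leib x x x; rewrite subrr {1}xE linearDr linearZr_LR /= => /eqP.
  rewrite addr_eq0 => /eqP xn.
  have : (w X : F) *: br x x \in N.
    by rewrite -[_ *: _]opprK -xn memvN; case: (idN (h (upper_mx w)) x (hN w)).
  have [w0 _|w0] := eqVneq (w X : F) 0; first by rewrite xE w0 scale0r addr0 hN.
  by move=> /(memvZ (w X : F)^-1); rewrite scalerA mulVf // scale1r.
rewrite !fE linearDl linearZl_LR /= memvD ?memvZ //.
  by case: (idN _ (h (upper_mx v) + (v X : F) *: x) (hN u)).
rewrite linearDr linearZr_LR /= memvD ?memvZ //.
by case: (idN _ x (hN v)).
Qed.

End Coordinates.

(** * Every algebra in L(4,1) is an extension [ext_bracket] *)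

Section Extension.
Variables (F : fieldType) (L : vectType F) (br : {bilinear L -> L -> L}).

Lemma sum_e (x : gen) (a : gen -> F) : \sum_g (e F x g : F) * a g = a x.
Proof. by rewrite big_gen !eE; case: x => /=; ring. Qed.

Lemma in_L41_ext : (2 : F) != 0 -> in_L41 br ->
  exists a12 a23 a34 p13 p24 p14 q13 q24 q14 r13 r14 f12 f23 f34 s : F,
    let S := a12 + a23 + a34 in
    [/\ br ~= ext_bracket a12 a23 a34 p13 p24 p14 q13 q24 q14 r13 r14 f12 f23 f34 s,
        [/\ f12 * S = 0, f23 * S = 0, f34 * S = 0 & s * S = 0]
      & [/\ f12 * a12 = 0, f23 * a23 = 0 & f34 * a34 = 0]].
Proof.
move=> two0 inL; have [leib _ _ _] := inL.
have [f [fK gK fT4 fX]] := in_L41_coordinates inL.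
pose B (u v : V7 F) : V7 F := (f^-1)%VF (br (f u) (f v)).
have B_iso : br ~= B.
  apply: (isomorphicI (f := (f^-1)%VF) (g := f)) => //; first exact: linearP.
  by move=> x y; rewrite /B !gK.
pose c g h k : F := B (e F g) (e F h) k.
have brZ a b x y : br (a *: x) (b *: y) = (a * b) *: br x y.
  by rewrite linearZl_LR linearZr_LR /= scalerA.
have fZ a x : f (a *: x) = a *: f x by rewrite linearZ.
have gZ a x : (f^-1)%VF (a *: x) = a *: (f^-1)%VF x by rewrite linearZ.
have BE u v k : B u v k = \sum_g \sum_h (u g * v h) * c g h k.
  rewrite /B {1}(V7_sum u) linear_sum linear_sumlz linear_sum sum_ffunE.
  apply: eq_bigr => g _.
  rewrite {1}(V7_sum v) !linear_sum sum_ffunE.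
  apply: eq_bigr => h _.
  by rewrite /= !fZ brZ gZ ffunE /GRing.scale.
pose r g k := c g X k; pose l h k := c X h k; pose s k := c X X k.
have cE g h k : c g h k = ext_coord r l s g h k.
  have c_X : k = X -> c g h k = 0 by move->; apply: fX.
  have c_T4 : in_T4 g -> in_T4 h -> c g h k = T4_coord F g h k.
    move=> gT hT; rewrite /c /B fT4 ?fK; try by rewrite eE; case: (g) (h) gT hT => -[].
    move: gT hT; clear; case: k; rewrite vecE ?eE; case: g => //; case: h => //= _ _; ring.
  case: k c_X c_T4 => c_X c_T4; try exact: c_X;
    by move: c_T4; case: (g) => //; case: (h) => // ->.
have leib_c x y z k : \sum_h c y z h * c x h k =
    \sum_g c x y g * c g z k - \sum_g c x z g * c g y k.
  have Bl x' (v : V7 F) : B (e F x') v k = \sum_h v h * c x' h k.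
    rewrite BE -[RHS](sum_e x' (fun g => \sum_h v h * c g h k)).
    by apply: eq_bigr => g _; rewrite mulr_sumr; apply: eq_bigr => h _; rewrite mulrA.
  have Br x' (v : V7 F) : B v (e F x') k = \sum_g v g * c g x' k.
    rewrite BE; apply: eq_bigr => g _; rewrite -[RHS](sum_e x' (fun h => v g * c g h k)).
    by apply: eq_bigr => h _; rewrite mulrA [_ * v g]mulrC.
  by rewrite -Bl -!Br /B !gK leib linearB !ffunE.
have leib_ext x y z k : \sum_h ext_coord r l s y z h * ext_coord r l s x h k =
    \sum_g ext_coord r l s x y g * ext_coord r l s g z k
    - \sum_g ext_coord r l s x z g * ext_coord r l s g y k.
  by have := leib_c x y z k; rewrite !big_gen -!cE.
have [_ [_ _ _ phiS phi0]] := ext_coord_leibniz two0 leib_ext.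
(* The witnesses are left open; the relations and then [ext_coordE] fix them as structure constants
   of the transported bracket [B]. *)
do 15 eexists; split; [|exact: phiS|exact: phi0].
apply: isomorphic_eqr B_iso => u v; apply: ext_coordE => // k.
by rewrite BE !big_gen !cE.
Qed.

End Extension.

(** * Consequences of being non-nilpotent and non-Lie, and the classification *)

Section Classification.
Variables (F : fieldType) (L : vectType F) (br : {bilinear L -> L -> L}).
Local Notation vec := (@vec7 F).

Lemma brv_sub (U V W : {vspace L}) :
  (forall u v, u \in U -> v \in V -> br u v \in W) -> (brv br U V <= W)%VS.
Proof.
move=> sub; apply/span_subvP => _ /allpairsP[[u v] /= [uU vV ->]].
by apply: sub; apply: vbasis_mem.
Qed.

Lemma vspace_of_linear (B : vectType F) (h : L -> B) : linear h ->
  exists W : {vspace L}, forall v, (v \in W) = (h v == 0).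
Proof.
move=> linh.
pose hL := HB.pack_for {linear L -> B} h (GRing.isLinear.Build _ _ _ _ h linh).
by exists (lker (linfun hL)) => v; rewrite memv_ker lfunE.
Qed.

(** With zero eigenvalues, every bracket moves down the chain L, <N13, N24, N14>, <N14>, 0. The
    middle terms are cut out as kernels of the coordinate maps [k1] and [k2]. *)
Lemma ext_nilpotent p13 p24 p14 q13 q24 q14 r13 r14 f12 f23 f34 s :
  br ~= ext_bracket 0 0 0 p13 p24 p14 q13 q24 q14 r13 r14 f12 f23 f34 s ->
  nilpotent_sub br fullv.
Proof.
case/isomorphicE=> f [fK gK fM].
pose k1 (u : V7 F) := vec (u N12) (u N23) (u N34) 0 0 0 (u X).
pose k2 (u : V7 F) := vec (u N12) (u N23) (u N34) (u N13) (u N24) 0 (u X).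
have fL c x y : f (c *: x + y) = c *: f x + f y by rewrite linearP.
have lin1 : linear (k1 \o f).
  by move=> c x y; rewrite /= fL; move: (f x) (f y); rewrite /k1; vec_eq ring.
have lin2 : linear (k2 \o f).
  by move=> c x y; rewrite /= fL; move: (f x) (f y); rewrite /k2; vec_eq ring.
have [W1 W1P] := vspace_of_linear lin1; have [W2 W2P] := vspace_of_linear lin2.
have zero : 0 = vec 0 0 0 0 0 0 0 by apply/ffunP; case; rewrite vecE ffunE.
(* Index 3 stands for L^4, the iteration starting from L^1 at index 0. *)
exists 3; apply/eqP; rewrite -subv0.
apply: (brv_sub (U := brv br (brv br fullv fullv) fullv)) => u v uU _.
have sub1 : (brv br fullv fullv <= W1)%VS.
  apply: brv_sub => x y _ _; rewrite W1P /= fM zero; apply/eqP.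
  by move: (f x) (f y); rewrite /k1; vec_eq ring.
have sub2 : (brv br (brv br fullv fullv) fullv <= W2)%VS.
  apply: brv_sub => x y /(subvP sub1) + _; rewrite W1P W2P /= fM zero => /eqP fx0.
  have : forall g, k1 (f x) g = 0 by move=> g; rewrite fx0 -zero ffunE.
  move=> k0; move: (k0 N12) (k0 N23) (k0 N34) (k0 X); rewrite !vecE {k0 fx0}.
  move: (f x) (f y) => a b a12 a23 a34 aX; apply/eqP.
  rewrite /k2 /ext_bracket !vecE a12 a23 a34 aX; congr vec7; ring.
move/(subvP sub2): uU; rewrite W2P memv0 /= zero => /eqP fu0.
have : forall g, k2 (f u) g = 0 by move=> g; rewrite fu0 -zero ffunE.
move=> k0; move: (k0 N12) (k0 N23) (k0 N34) (k0 N13) (k0 N24) (k0 X).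
rewrite !vecE => a12 a23 a34 a13 a24 aX.
apply/eqP; apply: (can_inj fK); rewrite fM linear0 zero /ext_bracket.
by rewrite a12 a23 a34 a13 a24 aX; congr vec7; ring.
Qed.

(** Without f and s the bracket is alternating, hence antisymmetric, and the Leibniz identity
    becomes the Jacobi identity. *)
Lemma ext_lie a12 a23 a34 p13 p24 p14 q13 q24 q14 r13 r14 :
  leibniz_algebra br ->
  br ~= ext_bracket a12 a23 a34 p13 p24 p14 q13 q24 q14 r13 r14 0 0 0 0 ->
  lie_algebra br.
Proof.
move=> leib /isomorphicE[f [fK gK fM]].
have alt x : br x x = 0.
  apply: (can_inj fK); rewrite fM linear0; move: (f x) => u.
  by apply/ffunP; case; rewrite /ext_bracket vecE ffunE; ring.
have anti x y : br x y = - br y x.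
  apply/eqP; rewrite -addr_eq0; apply/eqP.
  by have := alt (x + y); rewrite linearDl !linearDr !alt add0r addr0.
split=> // x y z.
by rewrite leib (anti y (br z x)) (anti z (br x y)) (anti z x) linearNl opprK subrK subrr.
Qed.

Lemma in_L41_classification : (2 : F) != 0 -> in_L41 br -> ~ lie_algebra br ->
  in_families br.
Proof.
move=> two0 inL nonlie; have [leib nonnil _ _] := inL.
have [a12 [a23 [a34 [p13 [p24 [p14 [q13 [q24 [q14 [r13
  [r14 [f12 [f23 [f34 [s H]]]]]]]]]]]]]]]
  := in_L41_ext two0 inL.
move: H => /= [iso [f12S f23S f34S sS] [f12a f23a f34a]].
have nz : (f12, f23, f34, s) != (0, 0, 0, 0).
  apply: contra_not_neq nonlie => -[z12 z23 z34 zs].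
  by move: iso; rewrite z12 z23 z34 zs; apply: ext_lie.
have S0 : a12 + a23 + a34 = 0.
  apply/eqP; apply: contraNT nz => Sn0.
  have cancelS (a : F) : a * (a12 + a23 + a34) = 0 -> a = 0.
    by move/eqP; rewrite mulf_eq0 (negPf Sn0) orbF => /eqP.
  by rewrite (cancelS _ f12S) (cancelS _ f23S) (cancelS _ f34S) (cancelS _ sS).
have a0 : (a12, a23) != (0, 0).
  apply: contra_not_neq nonnil => -[z12 z23].
  move: S0 iso; rewrite z12 z23 !add0r => ->; exact: ext_nilpotent.
have iso' := isomorphic_trans iso (ext_red p13 p24 p14 q13 q24 q14 r13 r14 f12 f23 f34 s S0).
(* The shift of s is a value of f, so it disappears when f does. *)
have nz' : (f12, f23, f34, s + f12 * q13 - f23 * p13 - f34 * q24) != (0, 0, 0, 0).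
  apply: contraNneq nz => -[-> -> ->].
  by rewrite !mul0r !subr0 addr0 => ->.
case: (red_classification p24 q14 r13 two0 S0 a0 f12a f23a f34a nz')
  => [[a [b [t [ok isoL]]]]|[a [b [t [ok isoL]]]]|[a [ok isoL]]].
- by apply: Or31; exists a, b, t; split=> //; apply: isomorphic_trans iso' isoL.
- by apply: Or32; exists a, b, t; split=> //; apply: isomorphic_trans iso' isoL.
- by apply: Or33; exists a; split=> //; apply: isomorphic_trans iso' isoL.
Qed.

End Classification.

(** * Non-isomorphism between the three families *)

Section Distinct.
Variable F : fieldType.

Lemma table_bracket_e (t : gen -> gen -> V7 F) g h :
  table_bracket t (e F g) (e F h) = t g h.
Proof.
apply/ffunP=> k; rewrite table_bracketE -[RHS](sum_e g (fun g => t g h k)).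
apply: eq_bigr => g' _; rewrite -[in RHS](sum_e h (fun h => t g' h k)) mulr_sumr.
by apply: eq_bigr => h' _; rewrite mulrA.
Qed.

(* [L3, L3] is spanned by the six N_ij, whereas the coordinates of X and of some
   other basis vector vanish on [brA, brA] when brA is L1 or L2. *)
Lemma not_iso_L3 (brA : V7 F -> V7 F -> V7 F) g0 a : g0 != X -> L3_params a ->
  (forall u v, brA u v g0 = 0 /\ brA u v X = 0) -> ~ (brA ~= L3 a).
Proof.
move=> g0X a_ok brA0 /isomorphicE[f [fK gK fM]].
pose g (u : V7 F) : V7 F := (f^-1)%VF u.
have gZ c u : g (c *: u) = c *: g u by rewrite /g linearZ.
have g_br h : h = g0 \/ h = X -> forall x y, g (L3 a x y) h = 0.
  move=> hP x y; have -> : g (L3 a x y) = brA (g x) (g y).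
    by apply: (can_inj fK); rewrite fM !gK.
  by have [H1 H2] := brA0 (g x) (g y); case: hP => ->.
have [a1 a0] : 1 + a != 0 /\ a != 0.
  by move/eqP: a_ok; rewrite mulf_eq0 negb_or => /andP.
have gN h k : in_T4 k -> h = g0 \/ h = X -> g (e F k) h = 0.
  move=> kT /g_br{}g_br.
  have gZ0 c (u : V7 F) : c != 0 -> g (c *: u) h = 0 -> g u h = 0.
    by move=> c0; rewrite gZ ffunE => /eqP; rewrite mulf_eq0 (negPf c0) => /eqP.
  case: k kT => // _.
  - by have := g_br (e F N12) (e F X); rewrite /L3 table_bracket_e.
  - by have := g_br (e F N23) (e F X); rewrite /L3 table_bracket_e => /gZ0->.
  - by have := g_br (e F X) (e F N34); rewrite /L3 table_bracket_e => /gZ0->.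
  - by have := g_br (e F N12) (e F N23); rewrite /L3 table_bracket_e.
  - by have := g_br (e F N23) (e F N34); rewrite /L3 table_bracket_e.
  - by have := g_br (e F N12) (e F N24); rewrite /L3 table_bracket_e.
have gE h (u : V7 F) : h = g0 \/ h = X -> g u h = u X * g (e F X) h.
  move=> hP; have -> : g u = \sum_k (u k : F) *: g (e F k).
    by rewrite {1}(V7_sum u) /g linear_sum; apply: eq_bigr => k _; rewrite linearZ.
  rewrite sum_ffunE big_gen !ffunE /GRing.scale /=.
  by rewrite !(gN h N12, gN h N23, gN h N34, gN h N13, gN h N24, gN h N14) // !mulr0 !add0r.
(* The coordinates [g0] and X of [g u] are both multiples of the single form [u X]; evaluation at
   the preimages of [e g0] and [e X] contradicts their independence. *)
have := gE g0 (f (e F g0)) (or_introl erefl).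
have := gE X (f (e F g0)) (or_intror erefl).
have := gE X (f (e F X)) (or_intror erefl).
rewrite /g !fK !ffunE eqxx eq_sym (negPf g0X) -/(g _) => E1 /esym/eqP E2 E3.
move: E2; rewrite mulf_eq0 => /orP[] /eqP E2.
  by move: E3; rewrite E2 mul0r eqxx => /eqP; rewrite oner_eq0.
by move: E1; rewrite E2 mulr0 => /eqP; rewrite oner_eq0.
Qed.

Lemma not_iso_L1_L3 a b s a' : L3_params a' -> ~ (L1 a b s ~= @L3 F a').
Proof.
(* N12 has eigenvalue 0 in L1, so its coordinate vanishes on all brackets; for L2 the same holds of
   N23. *)
move=> a'_ok; apply: (@not_iso_L3 _ N12) => // [|u v]; first by rewrite eq_genE.
by rewrite -!red_L1 /red_bracket /ext_bracket !vecE mul0r.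
Qed.

Lemma not_iso_L2_L3 a b s a' : L3_params a' -> ~ (L2 a b s ~= @L3 F a').
Proof.
move=> a'_ok; apply: (@not_iso_L3 _ N23) => // [|u v]; first by rewrite eq_genE.
by rewrite -!red_L2 /red_bracket /ext_bracket !vecE mul0r.
Qed.

(* [[L2, L2], [L2, L2]] is spanned by N14, while [[L1, L1], [L1, L1]] contains
   N24 and N14. *)
Lemma not_iso_L1_L2 (a b s a' b' s' : F) : ~ (L1 a b s ~= L2 a' b' s').
Proof.
move=> /isomorphicE[f [fK gK fM]].
have low u v : L2 a' b' s' u v N23 = 0 /\ L2 a' b' s' u v X = 0.
  by rewrite -!red_L2 /red_bracket /ext_bracket !vecE mul0r.
have B14 u v w z : let x := L2 a' b' s' (L2 a' b' s' u v) (L2 a' b' s' w z) in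
    x = (x N14 : F) *: e F N14.
  move=> x; apply/ffunP=> g; rewrite ffunE eE /GRing.scale /=.
  have [uv23 uvX] := low u v; have [wz23 wzX] := low w z.
  rewrite /x -red_L2 /red_bracket /ext_bracket; case: g; rewrite !vecE uv23 uvX wz23 wzX /=; ring.
have L124 : L1 a b s (L1 a b s (e F N23) (e F X)) (L1 a b s (e F X) (e F N34)) = e F N24.
  by rewrite /L1 !table_bracket_e.
have L114 : L1 a b s (L1 a b s (e F N12) (e F N23)) (L1 a b s (e F X) (e F N34)) = e F N14.
  by rewrite /L1 !table_bracket_e.
have [c f24] : exists c : F, f (e F N24) = c *: e F N14.
  by eexists; rewrite -L124 !fM; apply: B14.
have [d f14] : exists d : F, f (e F N14) = d *: e F N14.
  by eexists; rewrite -{1}L114 !fM; apply: B14.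
(* Both sides have image c d N14 under f. The coordinate N24 then gives d = 0, so f would kill
   N14. *)
have : d *: e F N24 = c *: e F N14.
  apply: (can_inj fK); rewrite !linearZ /= f24 f14 !scalerA mulrC //.
move=> /ffunP E; have := E N24; have := E N14.
rewrite !ffunE !eq_genE /GRing.scale /= !mulr0 !mulr1 => _ d0.
have : e F N14 = 0 by apply: (can_inj fK); rewrite f14 d0 scale0r linear0.
by move=> /ffunP/(_ N14)/eqP; rewrite !ffunE eqxx oner_eq0.
Qed.

End Distinct.

Theorem theorem4p1 (R : realType) :
  (forall (L : vectType R[i]) (br : {bilinear L -> L -> L}),
     in_L41 br -> ~ lie_algebra br ->
     [\/ exists a b s : R[i], L1_params a b s /\ br ~= L1 a b s,
         exists a b s : R[i], L2_params a b s /\ br ~= L2 a b s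
       | exists a : R[i], L3_params a /\ br ~= L3 a])
  /\
  (forall a b s a' b' s' a'' : R[i],
     L1_params a b s -> L2_params a' b' s' -> L3_params a'' ->
     [/\ ~ (L1 a b s ~= L2 a' b' s'),
         ~ (L1 a b s ~= L3 a'')
       & ~ (L2 a' b' s' ~= L3 a'')]).
Proof.
split=> [L br|a b s a' b' s' a'' _ _ a''_ok].
  by apply: in_L41_classification; rewrite Num.Theory.pnatr_eq0.
split; [exact: not_iso_L1_L2|exact: not_iso_L1_L3|exact: not_iso_L2_L3].
Qed.
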